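(* Let $n\ge 10$ be an integer, let $I_n$ denote the identity permutation in $\mathrm{Sym}(n)$, and let $$T_1(n)=\{(k,n):1\le k\le n-1\},\qquad T_2(n)=\{(i,j,n): 1\le i\le \lfloor n/2\rfloor,\ \lfloor n/2\rfloor+1\le j\le n-1\}.$$ Then $\{I_n\}\cup T_1(n)\cup T_2(n)$ is a maximal clique in $G(\Omega_n)$. Consequently, $\omega(n)\ge (n^2+2n)/4$ when $n$ is even and $\omega(n)\ge (n+1)^2/4$ when $n$ is odd.
   Context: $\mathrm{Sym}(n)$ is the symmetric group on $[n]=\{1,\dots,n\}$; permutations are multiplied right-to-left. A cycle $(i_1,\dots,i_k)$ of length $k>1$ sends $i_j\mapsto i_{j+1}$ for $1\le j\le k-1$, $i_k\mapsto i_1$, and fixes everything else; the identity is not a cycle. The Birkhoff polytope graph $G(\Omega_n)$ has vertex set $\mathrm{Sym}(n)$, and $\sigma_1,\sigma_2$ are adjacent iff $\sigma_1^{-1}\sigma_2$ is a (single) cycle of length $>1$. A clique is a set of pairwise adjacent vertices; it is maximal if it is not properly contained in another clique. $\omega(n)$ denotes the clique number of $G(\Omega_n)$, i.e. the maximum size of a clique. *)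

(* Defs.v *)
From mathcomp Require Import all_boot all_order all_fingroup all_algebra.

Set Implicit Arguments.
Unset Strict Implicit.
Unset Printing Implicit Defensive.

Section CyclePerm.
Variable T : finType.
Implicit Types (s : {perm T}) (c : seq T).

(* The permutation sending each entry of c to the following one, the last
   entry to the first one, and fixing everything else. [undup c] is c itself
   when the entries of c are distinct; it only makes the definition total. *)
Definition cycle_perm c : {perm T} :=
  perm (can_inj (prev_next (undup_uniq c))).

(* Cycles of length > 1. Bounding the length by #|T| loses nothing, since the
   entries are distinct (see is_cycleP), and makes the predicate boolean. *)
Definition is_cycle s : bool :=
  [exists k : 'I_#|T|.+1, exists c : k.-tuple T,
     [&& 1 < k, uniq c & s == cycle_perm c]].

Lemma is_cycleP s :
  reflect (exists c, [/\ 1 < size c, uniq c & s = cycle_perm c]) (is_cycle s).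
Proof.
apply: (iffP existsP) => [[k /existsP[c /and3P[k1 Uc /eqP->]]]|[c [c1 Uc ->]]].
  by exists c; rewrite size_tuple.
have ltc : size c < #|T|.+1 by rewrite ltnS -(card_uniqP Uc) max_card.
exists (Ordinal ltc); apply/existsP; exists (in_tuple c).
by rewrite /= c1 Uc eqxx.
Qed.

Lemma cycle_permE c x : uniq c -> cycle_perm c x = next c x.
Proof. by move=> Uc; rewrite permE undup_id. Qed.

End CyclePerm.

Section Clique.
Variables (V : finType) (e : rel V).

Definition clique (A : {set V}) : bool :=
  [forall x in A, forall y in A, (x != y) ==> e x y].

Definition maximal_clique (A : {set V}) : bool := maxset clique A.

Definition clique_number : nat := \max_(A : {set V} | clique A) #|A|.

End Clique.

(* MathComp composes permutations left to right, (s * t) x = t (s x), so the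
   right-to-left product of s1^-1 and s2 is written s2 * s1^-1. *)
Definition birkhoff_adj (n : nat) : rel 'S_n :=
  fun s1 s2 => is_cycle (s2 * s1^-1)%g.

Definition omega (n : nat) : nat := clique_number (@birkhoff_adj n).

(* The label i in {1, ..., n} is represented by the ordinal of value i - 1, so
   that i.+1 is the label of i : 'I_n, and [m.+1 == n] says m has label n. *)
Definition T1 (n : nat) : {set 'S_n} :=
  [set s | [exists k : 'I_n, exists m : 'I_n,
     [&& 1 <= k.+1 <= n - 1, m.+1 == n & s == cycle_perm [:: k; m]]]].

Definition T2 (n : nat) : {set 'S_n} :=
  [set s | [exists i : 'I_n, exists j : 'I_n, exists m : 'I_n,
     [&& 1 <= i.+1 <= n %/ 2, n %/ 2 + 1 <= j.+1 <= n - 1, m.+1 == n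
       & s == cycle_perm [:: i; j; m]]]].

(* Main.v *)
Require Import Defs.
From mathcomp Require Import all_boot all_order all_fingroup all_algebra.
From mathcomp Require Import zify.

(** The clique is a star: writing m for the point n, and A, B for the two
halves of the remaining points, it consists of 1, the transpositions (k m) and
the 3-cycles (i j m) with i in A and j in B. Pairwise adjacency is a finite
computation: the quotient of two members is a cycle on at most five points.

For maximality, let s be adjacent to every member. The single obstruction used
throughout is [cycle_adj_swap]: if t is adjacent to s, and s sends x and y
where t sends y and x, then t^-1 s exchanges x and y, so that, being a cycle, it
is that transposition and s agrees with t everywhere else.

If s fixes m, adjacency to the (k m) forces s to move every other point, so s
is one cycle on all of them; it must step from B to A somewhere, say from j to
i, and then the quotient by (i j m) exchanges m and j without fixing the rest
([hub_fixed_not_adj]). If s moves m, follow m |-> a |-> b. Either b = m and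
s = (a m), or adjacency to (b m) forces b |-> m, so that s = (a b m). Unless a
is in A and b in B, there is a 3-cycle of the star whose quotient with s is a
product of two disjoint transpositions ([hub_moved_in_star]).

For the lower bound on the clique number, s |-> (s m, s^-1 m) maps the star
onto the union of the diagonal with the product of A and B, which has
n + |A| |B| elements. *)

Set Implicit Arguments.
Unset Strict Implicit.
Unset Printing Implicit Defensive.

(** * Adjacency through cycles *)

Section Adjacency.
Variable T : finType.
Implicit Types (s t : {perm T}) (x y z : T) (A B : {set T}).

Definition cycle_adj : rel {perm T} := fun s t => is_cycle (t * s^-1)%g.

(** Writing t as s after a cycle avoids inverses and turns adjacency into a
pointwise comparison of two explicit permutations. *)
Lemma cycle_adj_seq s t c :
  1 < size c -> uniq c -> (forall x, t x = s (next c x)) -> cycle_adj s t.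
Proof.
move=> c1 Uc tE; apply/is_cycleP; exists c; split=> //.
by apply/permP=> x; rewrite permM tE permK cycle_permE.
Qed.

Lemma cycle_adj1 s : cycle_adj 1%g s = is_cycle s.
Proof. by rewrite /cycle_adj invg1 mulg1. Qed.

Lemma cycle_adj_sym s t : cycle_adj s t = cycle_adj t s.
Proof.
suff sub s' t' : cycle_adj s' t' -> cycle_adj t' s' by apply/idP/idP=> /sub.
case/is_cycleP=> c [c1 Uc def].
apply/is_cycleP; exists (rev c); rewrite size_rev rev_uniq; split=> //.
rewrite -[LHS]invgK invMg invgK def; apply/permP=> x.
apply: (@perm_inj _ (cycle_perm c)).
by rewrite permKV !cycle_permE ?rev_uniq // next_rev // next_prev.
Qed.

Lemma cycle_nontrivial s : is_cycle s -> exists x, s x != x.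
Proof.
case/is_cycleP=> -[|x [|y c]] [//= _ Uc ->]; exists x.
rewrite cycle_permE //= eqxx.
by case/andP: Uc; rewrite inE negb_or eq_sym; case/andP.
Qed.

(** The moved points of a cycle form one orbit, so a stable property holding at
one of them holds at all. This is the form in which being a single cycle is
used. *)
Lemma cycle_closed_moved s (P : pred T) x y :
  is_cycle s -> (forall z, P z -> P (s z)) -> P x -> s x != x -> s y != y ->
  P y.
Proof.
case/is_cycleP=> c [_ Uc ->] clP Px.
have moved z : cycle_perm c z != z -> z \in c.
  by rewrite cycle_permE // next_nth; case: ifP; rewrite ?eqxx.
move=> /moved cx /moved cy.
have: fconnect (next c) x y by rewrite (fconnect_cycle (cycle_next Uc)).
move/iter_findex=> <-; elim: (findex _ _ _) => //= k /clP.
by rewrite cycle_permE.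
Qed.

(** The quotient t^-1 s exchanges x and y; a cycle that does so moves nothing
else, hence s and t agree at every other point. *)
Lemma cycle_adj_swap t s x y z :
  cycle_adj t s -> s x = t y -> s y = t x -> x != y -> z != x -> z != y ->
  s z = t z.
Proof.
move=> st sx sy xy zx zy; apply/eqP; apply: contraTT xy => sz.
have ux : (s * t^-1)%g x = y by rewrite permM sx permK.
have uy : (s * t^-1)%g y = x by rewrite permM sy permK.
rewrite negbK eq_sym; apply: contraT => yx.
have := @cycle_closed_moved _ (pred2 x y) x z st.
rewrite /= eqxx ux (negPf zx) (negPf zy); apply=> //.
  by move=> w /orP[]/eqP->; rewrite ?ux ?uy eqxx ?orbT.
by apply: contra sz; rewrite permM => /eqP{2}<-; rewrite permKV.
Qed.

Lemma cycle2E k m x : k != m ->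
  cycle_perm [:: k; m] x = if x == k then m else if x == m then k else x.
Proof. by move=> km; rewrite cycle_permE //= inE km. Qed.

Lemma cycle3E i j m x : uniq [:: i; j; m] ->
  cycle_perm [:: i; j; m] x =
  if x == i then j else if x == j then m else if x == m then i else x.
Proof. by move=> Uc; rewrite cycle_permE. Qed.

End Adjacency.

(** Compares two explicit permutations at a point by splitting on which of the
named points it equals; the disequalities between them, Leibniz ones heading the
goal, discard the impossible cases. *)
Ltac decide_points :=
  simpl;
  repeat match goal with
  | |- context [if ?x == ?y then _ else _] =>
      is_var x; is_var y;
      case: (x =P y) => ? /=; try (exfalso; congruence)
  end; congruence.

(** * The star is a clique *)

Section StarClique.
Variables (T : finType) (m : T) (A B : {set T}).
Implicit Types (s t : {perm T}) (x y z a b i j k : T).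

Definition star2 : {set {perm T}} := [set cycle_perm [:: k; m] | k in A :|: B].
Definition star3 : {set {perm T}} :=
  [set cycle_perm [:: i; j; m] | i in A, j in B].
Definition star : {set {perm T}} := [set 1%g] :|: star2 :|: star3.

Hypotheses (mA : m \notin A) (mB : m \notin B) (AB : [disjoint A & B]).

Let Am i : i \in A -> i != m. Proof. by apply: contraTneq => ->. Qed.
Let Bm j : j \in B -> j != m. Proof. by apply: contraTneq => ->. Qed.
Let ABm k : k \in A :|: B -> k != m.
Proof. by rewrite inE => /orP[/Am|/Bm]. Qed.
Let neqAB i j : i \in A -> j \in B -> i != j.
Proof. by move=> iA; apply: contraTneq => <-; rewrite (disjointFr AB iA). Qed.
Let uniq3 i j : i \in A -> j \in B -> uniq [:: i; j; m].
Proof.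
by move=> iA jB; rewrite /= !inE negb_or (neqAB iA jB) (Am iA) (Bm jB).
Qed.

Lemma star1_in : 1%g \in star. Proof. by rewrite !inE eqxx. Qed.

Lemma star2_in k : k \in A :|: B -> cycle_perm [:: k; m] \in star.
Proof. by move=> kAB; rewrite !inE imset_f ?orbT. Qed.

Lemma star3_in i j : i \in A -> j \in B -> cycle_perm [:: i; j; m] \in star.
Proof. by move=> iA jB; rewrite !inE imset2_f ?orbT. Qed.

Variant star_spec : {perm T} -> Prop :=
| Star1 : star_spec 1%g
| Star2 k of k \in A :|: B : star_spec (cycle_perm [:: k; m])
| Star3 i j of i \in A & j \in B : star_spec (cycle_perm [:: i; j; m]).

Lemma starP s : s \in star -> star_spec s.
Proof.
rewrite 2!in_setU in_set1 => /orP[/orP[/eqP->|/imsetP[k kAB ->]]|].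
- exact: Star1.
- exact: Star2.
by case/imset2P=> i j iA jB ->; apply: Star3.
Qed.

Lemma adj_1_2 k : k \in A :|: B -> cycle_adj 1%g (cycle_perm [:: k; m]).
Proof.
move/ABm=> km; have Uc : uniq [:: k; m] by rewrite /= inE km.
by apply: cycle_adj_seq (Uc) _ => // x; rewrite perm1 cycle_permE.
Qed.

Lemma adj_1_3 i j : i \in A -> j \in B ->
  cycle_adj 1%g (cycle_perm [:: i; j; m]).
Proof.
move=> iA jB; apply: cycle_adj_seq (uniq3 iA jB) _ => // x.
by rewrite perm1 cycle_permE ?uniq3.
Qed.

Lemma adj_2_2 k l : k \in A :|: B -> l \in A :|: B -> k != l ->
  cycle_adj (cycle_perm [:: k; m]) (cycle_perm [:: l; m]).
Proof.
move=> /ABm km /ABm lm kl.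
apply: (@cycle_adj_seq _ _ _ [:: l; k; m]) => //.
  by rewrite /= !inE negb_or eq_sym kl km lm.
move=> x; rewrite !cycle2E //=.
by move/eqP: km; move/eqP: lm; move/eqP: kl; decide_points.
Qed.

Lemma adj_2_3 k i j : k \in A :|: B -> i \in A -> j \in B ->
  cycle_adj (cycle_perm [:: k; m]) (cycle_perm [:: i; j; m]).
Proof.
move=> /ABm km iA jB; have Uc := uniq3 iA jB.
have [im jm ij] := And3 (Am iA) (Bm jB) (neqAB iA jB).
have [ki | ki] := eqVneq k i; last have [kj | kj] := eqVneq k j.
- apply: (@cycle_adj_seq _ _ _ [:: i; j]); rewrite //= ?inE ?ij // => x.
  rewrite cycle2E // cycle3E // ki.
  by move/eqP: im; move/eqP: jm; move/eqP: ij; decide_points.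
- apply: (@cycle_adj_seq _ _ _ [:: i; m]); rewrite //= ?inE ?im // => x.
  rewrite cycle2E // cycle3E // kj.
  by move/eqP: im; move/eqP: jm; move/eqP: ij; decide_points.
apply: (@cycle_adj_seq _ _ _ [:: i; j; k; m]) => //=.
  by rewrite !inE !negb_or ij im jm km !(eq_sym _ k) ki kj.
move=> x; rewrite cycle2E // cycle3E //.
move/eqP: im; move/eqP: jm; move/eqP: ij; move/eqP: ki; move/eqP: kj.
by move/eqP: km; decide_points.
Qed.

Lemma adj_3_3 i j i' j' :
    i \in A -> j \in B -> i' \in A -> j' \in B ->
    cycle_perm [:: i; j; m] != cycle_perm [:: i'; j'; m] ->
  cycle_adj (cycle_perm [:: i; j; m]) (cycle_perm [:: i'; j'; m]).
Proof.
move=> iA jB iA' jB' neq; have [Uc Uc'] := (uniq3 iA jB, uniq3 iA' jB').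
have [im jm ij] := And3 (Am iA) (Bm jB) (neqAB iA jB).
have [im' jm' ij'] := And3 (Am iA') (Bm jB') (neqAB iA' jB').
have [i'j ji'] := (neqAB iA' jB, neqAB iA jB').
have [ii' | ii'] := eqVneq i i'; have [jj' | jj'] := eqVneq j j'.
- by rewrite ii' jj' eqxx in neq.
- apply: (@cycle_adj_seq _ _ _ [:: i; j'; j]) => //=.
    by rewrite !inE negb_or ij ji' eq_sym jj'.
  move=> x; rewrite !cycle3E // -ii'.
  move/eqP: im; move/eqP: jm; move/eqP: ij; move/eqP: jj'; move/eqP: jm'.
  by move/eqP: ji'; decide_points.
- apply: (@cycle_adj_seq _ _ _ [:: i'; i; m]) => //=.
    by rewrite !inE negb_or im im' eq_sym ii'.
  move=> x; rewrite !cycle3E // -jj'.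
  move/eqP: im; move/eqP: jm; move/eqP: ij; move/eqP: ii'; move/eqP: im'.
  by move/eqP: i'j; decide_points.
apply: (@cycle_adj_seq _ _ _ [:: i'; j'; j; i; m]) => //=.
  rewrite !inE !negb_or im jm im' jm' ij' i'j (eq_sym i' i) ii' (eq_sym j' j).
  by rewrite jj' (eq_sym j' i) ji' (eq_sym j i) ij.
move=> x; rewrite !cycle3E //.
move/eqP: im; move/eqP: jm; move/eqP: ij; move/eqP: ii'; move/eqP: jj'.
move/eqP: im'; move/eqP: jm'; move/eqP: ij'; move/eqP: ji'; move/eqP: i'j.
by decide_points.
Qed.

Lemma star_clique : clique (@cycle_adj T) star.
Proof.
apply/forall_inP=> s sS; apply/forall_inP=> t tS; apply/implyP.
case/starP: sS => [|k kAB|i j iA jB]; case/starP: tS => [|l lAB|i' j' iA' jB'].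
- by rewrite eqxx.
- by rewrite adj_1_2.
- by rewrite adj_1_3.
- by rewrite cycle_adj_sym adj_1_2.
- by move=> neq; apply: adj_2_2 => //; apply: contraNneq neq => ->.
- by rewrite adj_2_3.
- by rewrite cycle_adj_sym adj_1_3.
- by rewrite cycle_adj_sym adj_2_3.
exact: adj_3_3.
Qed.

Hypotheses (cover : forall x, x != m -> x \in A :|: B).
Hypotheses (A_gt0 : 0 < #|A|) (B_gt1 : 1 < #|B|).

(** * Maximality of the star *)

(** Such an s would move all points but m: if it fixed some k <> m, the quotient
by (k m) would exchange k and m, so s would agree with (k m) elsewhere and be
the identity. As s is one cycle meeting A and B, B is not stable, which
gives j in B with s j in A; the quotient by (s j, j, m) exchanges m and j, and
moves any point other than m, j and the preimage of j. *)
Lemma hub_fixed_not_adj s :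
  s m = m -> (forall t, t \in star -> cycle_adj t s) -> False.
Proof.
move=> sm adj; have cs : is_cycle s by rewrite -cycle_adj1 adj ?star1_in.
have moved k : k != m -> s k != k.
  move=> km; apply/eqP=> sk; have [z sz] := cycle_nontrivial cs.
  have [zk zm] : z != k /\ z != m.
    by split; apply: contraNneq sz => ->; rewrite ?sk ?sm.
  have := cycle_adj_swap (adj _ (star2_in (cover km))) _ _ km zk zm.
  rewrite !cycle2E // eqxx (eq_sym m) (negPf km) eqxx (negPf zk) (negPf zm).
  by move/(_ sk sm)/eqP; rewrite (negPf sz).
have [j jB sjA] : exists2 j, j \in B & s j \in A.
  apply/exists_inP; apply: contraT; rewrite negb_exists_in => /forall_inP nex.
  have [/card_gt0P[a aA] /card_gt0P[b bB]] := (A_gt0, ltnW B_gt1).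
  have clB z : z \in B -> s z \in B.
    move=> zB; have: s z \in A :|: B.
      by apply: cover; rewrite -sm (inj_eq perm_inj) Bm.
    by rewrite inE (negPf (nex z zB)).
  have := cycle_closed_moved cs clB bB (moved b (Bm bB)) (moved a (Am aA)).
  by rewrite (disjointFr AB aA).
have [Uc ij im jm] := And4 (uniq3 sjA jB) (neqAB sjA jB) (Am sjA) (Bm jB).
(* Four points are available: m, at least one in A and at least two in B. *)
have /card_gt0P[z] : 0 < #|~: [set m; j; s^-1%g j]|.
  rewrite cardsCs setCK subn_gt0; apply: leq_ltn_trans (_ : 3 < _).
    by rewrite -setUA cardsU1 cards2; case: (_ \notin _); case: (_ != _).
  have -> : #|T| = #|m |: (A :|: B)|.
    rewrite -cardsT; apply: eq_card => x; rewrite !in_setU in_set1 inE.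
    by have [//|/cover] := eqVneq x m; rewrite inE.
  rewrite cardsU1 inE negb_or mA mB cardsU (disjoint_setI0 AB) cards0 subn0.
  by rewrite addnA (@leq_add 2 2).
rewrite !inE !negb_or => /andP[/andP[zm zj] zsj].
have szj : s z != j by apply: contraNneq zsj => <-; rewrite permK.
have := cycle_adj_swap (adj _ (star3_in sjA jB)) _ _ jm zj zm.
rewrite !cycle3E // !eqxx sm (eq_sym m) (negPf im) (eq_sym m) (negPf jm).
rewrite (eq_sym j) (negPf ij) (negPf zj) (negPf zm).
by case: eqP => _ /(_ erefl erefl)/eqP; apply/negP; rewrite ?moved.
Qed.

(** The orbit m |-> a |-> b of the hub determines s: adjacency to (b m) forces
b |-> m, and the members starting at b, or ending at a then m, exclude the wrong
orientations and the pairs inside one part. *)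
Lemma hub_moved_in_star s :
  s m != m -> (forall t, t \in star -> cycle_adj t s) -> s \in star.
Proof.
move=> sm adj; have cs : is_cycle s by rewrite -cycle_adj1 adj ?star1_in.
have [a Da] : exists a, a = s m by exists (s m).
have [b Db] : exists b, b = s a by exists (s a).
have am : a != m by rewrite Da.
have ba : b != a by rewrite Db {2}Da (inj_eq perm_inj).
have [bm | bm] := eqVneq b m.
  suff -> : s = cycle_perm [:: a; m] by apply/star2_in/cover.
  apply/permP=> z; rewrite cycle2E //.
  have [->|za] := eqVneq z a; first by rewrite -Db.
  have [->|zm] := eqVneq z m; first by rewrite -Da.
  rewrite (cycle_adj_swap (adj _ star1_in) _ _ am za zm) ?perm1 //.
    by rewrite -Db.
have [aAB bAB] := (cover am, cover bm).
(* The quotient by (b m) exchanges m and a, so s agrees with (b m) at b. *)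
have sb : s b = m.
  rewrite (@cycle_adj_swap _ _ _ m a b (adj _ (star2_in bAB))) //.
  - by rewrite cycle2E // eqxx.
  - by rewrite cycle2E // eq_sym (negPf ba) (negPf am).
  - by rewrite cycle2E // eq_sym (negPf bm) eqxx.
  by rewrite eq_sym.
have {}Da := esym Da; have {}Db := esym Db.
have sE : s = cycle_perm [:: a; b; m].
  apply/permP=> z; rewrite cycle3E; last first.
    by rewrite /= !inE negb_or am bm eq_sym ba.
  have [->//|za] := eqVneq z a; have [->//|zb] := eqVneq z b.
  have [->//|zm] := eqVneq z m; apply/eqP; apply: contraT => sz.
  have := @cycle_closed_moved _ s (pred3 a b m) m z cs.
  rewrite /= (negPf za) (negPf zb) (negPf zm) eqxx !orbT Da; apply=> // w.
  by case/or3P=> /eqP->; rewrite ?Da ?Db ?sb eqxx ?orbT.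
(* If b is in A, then for j in B other than a the quotient by (b j m) exchanges
   m and a but does not fix b; this is where B needs two points. *)
have [bA | bA] := boolP (b \in A).
  have /card_gt0P[j] : 0 < #|B :\ a|.
    by have := B_gt1; rewrite (cardsD1 a B); case: (a \in B) => [|/ltnW].
  rewrite !inE => /andP[ja jB].
  have [Uc jm bj] := And3 (uniq3 bA jB) (Bm jB) (neqAB bA jB).
  have := @cycle_adj_swap _ _ _ m a b (adj _ (star3_in bA jB)).
  rewrite !cycle3E // !eqxx Da Db sb ![a == _]eq_sym ![m == _]eq_sym.
  rewrite (negPf ba) (negPf ja) (negPf am) (negPf bm) (negPf jm).
  move/(_ erefl erefl erefl erefl erefl)/eqP.
  by rewrite eq_sym (negPf jm).
have bB : b \in B by move: bAB; rewrite inE (negPf bA).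
have [aA | aA] := boolP (a \in A); first by rewrite sE star3_in.
have aB : a \in B by move: aAB; rewrite inE (negPf aA).
(* If a and b are both in B, the quotient by (i a m) exchanges a and b but does
   not fix m. *)
have /card_gt0P[i iA] := A_gt0.
have [Uc im ia ib] := And4 (uniq3 iA aB) (Am iA) (neqAB iA aB) (neqAB iA bB).
have := @cycle_adj_swap _ _ _ a b m (adj _ (star3_in iA aB)).
rewrite !cycle3E // !eqxx Da Db sb ![_ == i]eq_sym.
rewrite (negPf ia) (negPf ib) (negPf im) (negPf ba) (negPf bm).
rewrite ![m == _]eq_sym (negPf am) (negPf bm) (eq_sym a b) (negPf ba).
move/(_ erefl erefl erefl erefl erefl)/eqP.
by rewrite eq_sym (negPf ia).
Qed.

Theorem star_maximal_clique : maximal_clique (@cycle_adj T) star.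
Proof.
apply/maxsetP; split=> [|C clC sSC]; first exact: star_clique.
apply/eqP; rewrite eqEsubset sSC andbT; apply/subsetP=> s sC.
apply: contraT => sS.
have adj t : t \in star -> cycle_adj t s.
  move=> tS; move/forall_inP/(_ t (subsetP sSC t tS))/forall_inP: clC.
  by move/(_ s sC)/implyP; apply; apply: contraNneq sS => <-.
have [sm | sm] := eqVneq (s m) m; first by case: (hub_fixed_not_adj sm adj).
by rewrite hub_moved_in_star in sS.
Qed.

(** * Size of the star *)

(** A member s is recovered from the pair (s m, s^-1 m), which is (m, m) for 1,
(k, k) for (k m) and (i, j) for (i j m). *)
Lemma card_star_ge : #|T| + #|A| * #|B| <= #|star|.
Proof.
pose f s := (s m, (s^-1)%g m).
pose D := [set (x, x) | x : T].
have injd : injective (fun x : T => (x, x)) by move=> x y [].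
have <- : #|D :|: setX A B| = #|T| + #|A| * #|B|.
  rewrite cardsU cardsX card_imset // (_ : D :&: _ = set0) ?cards0 ?subn0 //.
  apply/setP=> -[x y]; rewrite !inE /=.
  apply/negP=> /and3P[/imsetP[z _ [-> ->]]].
  by move=> zA; rewrite (disjointFr AB zA).
apply: leq_trans (leq_imset_card f star); apply/subset_leq_card/subsetP.
have inv s x : s x = m -> (s^-1)%g m = x by move=> <-; rewrite permK.
case=> x y /setUP[/imsetP[z _ [-> ->]]|/setXP[/= xA yB]].
  have [->|zm] := eqVneq z m.
    by apply/imsetP; exists 1%g; rewrite ?star1_in // /f invg1 perm1.
  apply/imsetP; exists (cycle_perm [:: z; m]); first exact/star2_in/cover.
  rewrite /f (inv _ z) cycle2E ?eqxx //.
  by rewrite eq_sym (negPf zm).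
apply/imsetP; exists (cycle_perm [:: x; y; m]); first exact: star3_in.
have [Uc xm ym xy] := And4 (uniq3 xA yB) (Am xA) (Bm yB) (neqAB xA yB).
rewrite /f (inv _ y) cycle3E // ?eqxx; last by rewrite eq_sym (negPf xy).
by rewrite !(eq_sym m) (negPf xm) (negPf ym).
Qed.

End StarClique.

Lemma leq_clique_number (V : finType) (e : rel V) (A : {set V}) :
  clique e A -> #|A| <= clique_number e.
Proof.
by move=> clA; apply: (@leq_bigmax_cond _ _ (fun C : {set V} => #|C|)).
Qed.

Lemma card_ord_lt n h : h <= n -> #|[set i : 'I_n | i < h]| = h.
Proof.
move=> hn.
have inj : injective (widen_ord hn) by move=> i j [] /val_inj.
rewrite -[RHS]card_ord -(card_imset _ inj).
apply: eq_card => i; rewrite inE; apply/idP/imsetP => [ih | [j _ ->] //=].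
by exists (Ordinal ih) => //; apply: val_inj.
Qed.

(** * The star on the labels 1, ..., n *)

Definition low n : {set 'I_n} := [set i : 'I_n | i < n %/ 2].
Definition high n : {set 'I_n} := [set j : 'I_n | n %/ 2 <= j < n.-1].

Section Labels.
Variable p : nat.
Local Notation n := p.+1.

Lemma T1_star2 : T1 n = star2 ord_max (low n) (high n).
Proof.
apply/setP=> s; rewrite inE; apply/existsP/imsetP.
  case=> k /existsP[l /and3P[kn /eqP[lp] /eqP->]].
  exists k; first by rewrite !inE; lia.
  by congr (cycle_perm [:: k; _]); apply: val_inj.
case=> k; rewrite !inE => kn ->; exists k; apply/existsP; exists ord_max.
by rewrite eqxx /= eqxx andbT /=; lia.
Qed.

Lemma T2_star3 : T2 n = star3 ord_max (low n) (high n).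
Proof.
apply/setP=> s; rewrite inE; apply/existsP/imset2P.
  case=> i /existsP[j /existsP[l /and4P[ih jh /eqP[lp] /eqP->]]].
  exists i j; rewrite ?inE; try lia.
  by congr (cycle_perm [:: i; j; _]); apply: val_inj.
case=> i j; rewrite !inE => ih jh ->; exists i; apply/existsP; exists j.
apply/existsP; exists ord_max; rewrite eqxx /= eqxx !andbT /=; lia.
Qed.

Lemma card_low : #|low n| = n %/ 2.
Proof. by rewrite card_ord_lt //; lia. Qed.

Lemma card_high : #|high n| = p - n %/ 2.
Proof.
have -> : high n = [set j : 'I_n | j < p] :\: low n.
  by apply/setP=> j; rewrite !inE -leqNgt.
rewrite cardsD (setIidPr _) ?card_low ?card_ord_lt //.
by apply/subsetP=> j; rewrite !inE; lia.
Qed.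

End Labels.

Theorem theorem2p9 (n : nat) (hn : 10 <= n) :
  [/\ maximal_clique (@birkhoff_adj n) ([set 1%g] :|: T1 n :|: T2 n),
      ~~ odd n -> (((n ^ 2 + 2 * n)%:R / 4%:R : rat) <= (omega n)%:R)%R
    & odd n -> ((((n + 1) ^ 2)%:R / 4%:R : rat) <= (omega n)%:R)%R].
Proof.
case: n hn => // p hn; rewrite T1_star2 T2_star3 -/(star _ _ _).
set lo := low _; set hi := high _.
have mA : ord_max \notin lo by rewrite inE /=; lia.
have mB : ord_max \notin hi by rewrite inE /=; lia.
have AB : [disjoint lo & hi].
  by rewrite -setI_eq0; apply/eqP/setP=> i; rewrite !inE; lia.
have cover x : x != ord_max -> x \in lo :|: hi.
  by rewrite !inE -val_eqE /=; have := ltn_ord x; lia.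
have max : maximal_clique (@birkhoff_adj p.+1) (star ord_max lo hi).
  by apply: star_maximal_clique; rewrite ?card_low ?card_high //; lia.
have := leq_clique_number (maxsetp max); rewrite -/(omega _).
have := card_star_ge mA mB AB cover.
rewrite card_ord card_low card_high => /leq_trans/[apply] le_omega.
split=> // par;
  rewrite Num.Theory.ler_pdivrMr ?Num.Theory.ltr0n //;
  rewrite -GRing.natrM Num.Theory.ler_nat.
  have [q Dq] : exists q, p.+1 = q * 2 by exists (p.+1 %/ 2); lia.
  by move: le_omega; rewrite Dq mulnK //; nia.
have [q Dq] : exists q, p.+1 = q * 2 + 1 by exists (p.+1 %/ 2); lia.
by move: le_omega; rewrite Dq divnMDl // divn_small // addn0; nia.
Qed.
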